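(* Let $f\colon(0,1)\to(0,\infty)$ be an increasing function such that $$\int_0^1 \frac{f(t)}{t}\,dt<\infty$$ and let $\mu$ be a measure on $\mathbb{R}^n$. (1) If $\theta\in S^{n-1}$, then $$\liminf_{r\downarrow 0}\frac{\mu\bigl(B(x,r)\setminus H(x,\theta)\bigr)}{f(r)\,\mu\bigl(B(x,r)\bigr)}\ge 1$$ for $\mu$-almost all $x\in\mathbb{R}^n$. (2) If $0<\alpha\le 1$, then $$\liminf_{r\downarrow 0}\ \inf_{\theta\in S^{n-1}}\frac{\mu\bigl(B(x,r)\setminus H(x,\theta,\alpha)\bigr)}{f(r)\,\mu\bigl(B(x,r)\bigr)}\ge 1$$ for $\mu$-almost all $x\in\mathbb{R}^n$.
   Context: A measure on $\mathbb{R}^n$ ($n\in\mathbb{N}$, $n\ge 1$) means a nontrivial Borel regular outer measure defined on all subsets of $\mathbb{R}^n$ such that bounded sets have finite measure. $B(x,r)$ is the closed ball with centre $x$ and radius $r>0$, and $S^{n-1}$ is the unit sphere of $\mathbb{R}^n$. For $x\in\mathbb{R}^n$, $\theta\in S^{n-1}$ and $0\le\alpha\le 1$, $H(x,\theta,\alpha)=\{y\in\mathbb{R}^n:(y-x)\cdot\theta>\alpha|y-x|\}$, and $H(x,\theta)=H(x,\theta,0)$ is the open half-space. *)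

(* Defs.v *)
From HB Require Import structures.
From mathcomp Require Import all_boot all_order all_algebra.
From mathcomp Require Import all_classical all_reals all_analysis.

Set Implicit Arguments.
Unset Strict Implicit.
Unset Printing Implicit Defensive.

Import Order.TTheory GRing.Theory Num.Theory.
Import numFieldNormedType.Exports.

Local Open Scope classical_set_scope.
Local Open Scope ring_scope.

Definition dotv (R : realType) (n : nat) (u v : 'rV[R]_n) : R :=
  \sum_(i < n) u 0 i * v 0 i.

(* The norm `|x| that the library puts on 'rV[R]_n is the sup norm, hence the
   separate Euclidean norm. Both norms induce the same topology and the same
   bounded sets, so [open] and [bounded_set] from the library are used as is. *)
Definition enorm (R : realType) (n : nat) (x : 'rV[R]_n) : R :=
  Num.sqrt (dotv x x).

Definition ecball (R : realType) (n : nat) (x : 'rV[R]_n) (r : R) :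
  set 'rV[R]_n := [set y | enorm (y - x) <= r].

Definition esphere (R : realType) (n : nat) : set 'rV[R]_n :=
  [set theta | enorm theta = 1].
Arguments esphere : clear implicits.

Definition hcone (R : realType) (n : nat) (x theta : 'rV[R]_n) (alpha : R) :
  set 'rV[R]_n := [set y | alpha * enorm (y - x) < dotv (y - x) theta].

Definition hspace (R : realType) (n : nat) (x theta : 'rV[R]_n) :
  set 'rV[R]_n := hcone x theta 0.

Definition borel (R : realType) (n : nat) : set_system 'rV[R]_n :=
  <<s (@open 'rV[R]_n) >>.
Arguments borel : clear implicits.

Record is_measure (R : realType) (n : nat)
    (mu : {outer_measure set 'rV[R]_n -> \bar R}) : Prop := IsMeasure {
  measure_nontrivial : mu setT <> 0%E ;
  measure_borel : forall B, borel R n B -> mu.-caratheodory B ;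
  measure_regular : forall A, exists B,
    [/\ borel R n B, A `<=` B & mu B = mu A] ;
  measure_bounded : forall A, bounded_set A -> (mu A < +oo)%E }.

(* [mu] is defined on all subsets, so being mu-null needs no measurable
   superset. *)
Definition mu_almost_all (R : realType) (n : nat)
    (mu : {outer_measure set 'rV[R]_n -> \bar R}) (P : 'rV[R]_n -> Prop) :=
  mu [set x | ~ P x] = 0%E.

(* Division in \bar R: if mu (B(x,r)) = 0 the quotient is 0 * +oo = 0. *)
Definition density_ratio (R : realType) (n : nat) (f : R -> R)
    (mu : {outer_measure set 'rV[R]_n -> \bar R})
    (x : 'rV[R]_n) (H : set 'rV[R]_n) (r : R) : \bar R :=
  (mu (ecball x r `\` H) / ((f r)%:E * mu (ecball x r)))%E.

(* Main.v *)
Require Import Defs.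
From HB Require Import structures.
From mathcomp Require Import all_boot all_order all_algebra.
From mathcomp Require Import all_classical all_reals all_analysis.
From mathcomp Require Import measurable_realfun ring lra.

(** Why the theorem is true.  Fix a direction w and a scale s, and call x bad
    at scale s if the part of B(x,s) behind x, that is outside H(x,w), has
    measure at most f(2s) mu(B(x,2s)).  In a set Q of diameter at most s, take
    a bad point x whose component along w is almost maximal: nearly all the bad
    points of Q lie in Q and behind x, hence in B(x,s) minus H(x,w), so they
    have measure at most f(2s) mu(B(x,2s)).  Cut space into cubical tiles of
    diameter at most s and sum over them.  Each ball B(x,2s) meets only a
    number of tiles that depends on n alone, so the bad points of a bounded
    region have measure at most C f(2s) times the measure of a slightly larger
    bounded region; this is [outer_measure_thin_behind_le].

    For s = 2^-(k+2) these bounds are summable in k, because f is increasing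
    and f(t)/t has a finite integral ([dyadic_sum_lt_pinfty]).  By the lemma of
    Borel and Cantelli almost every x is bad at only finitely many of these scales, and
    monotonicity in the radius interpolates between the dyadic scales:
    almost surely f(r) mu(B(x,r)) < mu(B(x,r) minus H(x,w)) for all small r
    ([almost_all_mass_behind]).  The strict inequality also excludes the points
    with mu(B(x,r)) = 0, and it gives part (1).

    For part (2), a cone H(x,theta,alpha) is contained in the half-space
    H(x,v) as soon as v is close enough to theta, depending on alpha
    ([hcone_sub_hspace]).  Finitely many v serve for all unit vectors theta,
    so part (2) follows from finitely many instances of the same estimate. *)

Set Implicit Arguments.
Unset Strict Implicit.
Unset Printing Implicit Defensive.

Import Order.TTheory GRing.Theory Num.Theory.
Import numFieldNormedType.Exports.

Local Open Scope classical_set_scope.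
Local Open Scope ring_scope.

(** * Outer measures and the fibres of a map *)

Lemma outer_measure_le_sum_fibres (R : realType) (T : Type) (I : eqType)
    (mu : {outer_measure set T -> \bar R}) (c : T -> I) (s : seq I)
    (A : set T) :
  (forall x, A x -> c x \in s) ->
  (mu A <= \sum_(k <- s) mu (A `&` c @^-1` [set k]))%E.
Proof.
elim: s A => [|k s IH] A As.
  rewrite big_nil (_ : A = set0) ?outer_measure0//.
  by apply/seteqP; split=> x // /As.
rewrite big_cons -{1}(setUIDK A (c @^-1` [set k])).
apply: (le_trans (outer_measureU2 mu _ _)).
apply: leeD => //; apply: (le_trans (IH _ _)).
  by move=> x [/As]; rewrite inE => /orP[/eqP|].
by apply: lee_sum => i _; apply: le_outer_measure => x [[]].
Qed.

Lemma sum_fibres_le_outer_measure (R : realType) (T : Type) (I : eqType)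
    (mu : {outer_measure set T -> \bar R}) (c : T -> I) (s : seq I)
    (D : set T) :
  uniq s -> (forall k, mu.-caratheodory (c @^-1` [set k])) ->
  (\sum_(k <- s) mu (D `&` c @^-1` [set k]) <= mu D)%E.
Proof.
move=> us mc; elim: s us D => [|k s IH] /= us D.
  by rewrite big_nil outer_measure_ge0.
move: us => /andP[ks us]; rewrite big_cons [leRHS](mc k D).
apply: leeD => //; apply: le_trans (IH us _).
rewrite big_seq [leRHS]big_seq; apply: lee_sum => i si.
apply: le_outer_measure => x [Dx /= ci]; split=> //; split=> //= ck.
by move: ks; rewrite -ck ci si.
Qed.

(** The supremum S of [phi] on [A] is approached by points of [A], so the
    bound on the sublevels at points of [A] passes to the sublevels below S,
    and then to their union.  The sublevels are taken in [Q], not in [A],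
    because continuity from below needs measurable sets. *)
Lemma outer_measure_le_of_sublevels (R : realType) (T : pointedType)
    (mu : {outer_measure set T -> \bar R}) (phi : T -> R) (Q A : set T)
    (M : R) (a : \bar R) :
  mu.-caratheodory Q -> (forall t, mu.-caratheodory [set y | phi y <= t]) ->
  A `<=` Q -> (forall x, A x -> phi x <= M) -> (0 <= a)%E ->
  (forall x, A x -> (mu (Q `&` [set y | (phi y <= phi x)%R]) <= a)%E) ->
  (mu A <= a)%E.
Proof.
move=> mQ mphi AQ AM a0 Aa.
have [->|/set0P[x0 Ax0]] := eqVneq A set0; first by rewrite outer_measure0.
have supA : has_sup (phi @` A).
  by split; [exists (phi x0), x0|exists M => _ [x Ax <-]; exact: AM].
set S := sup (phi @` A).
have AS x : A x -> phi x <= S.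
  by move=> Ax; apply: sup_upper_bound => //; exists x.
(* If S is attained at x, the sublevel at x already contains A. *)
have [[x [Ax xS]]|nS] := pselect (exists x, A x /\ phi x = S).
  apply: le_trans (Aa x Ax); apply: le_outer_measure => y Ay.
  by split; [exact: AQ|rewrite /= xS AS].
pose E j := Q `&` [set y | phi y <= S - j.+1%:R^-1].
have mE j : mu.-caratheodory (E j) by exact: caratheodory_measurable_setI.
have ndE : nondecreasing_seq E.
  move=> i j ij; rewrite subsetEset; apply: setIS => y /= /le_trans; apply.
  by rewrite lerB// lef_pV2 ?posrE// ler_nat.
have cE := @nondecreasing_cvg_mu _ (caratheodory_type mu) R mu E mE
  (caratheodory_measurable_bigcup mE) ndE.
apply: (@le_trans _ _ (mu (\bigcup_j E j))).
  apply: le_outer_measure => x Ax.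
  have xS : phi x < S.
    by rewrite lt_neqAle AS// andbT; apply/eqP => xS; apply: nS; exists x.
  have [j jx] : exists j, j.+1%:R^-1 < S - phi x.
    have := near_infty_natSinv_lt (PosNum (etrans (subr_gt0 _ _) xS)).
    by case=> j _ /(_ j (leqnn j)) /=; exists j.
  by exists j => //; split; [exact: AQ|rewrite /= lerBrDl -lerBrDr ltW].
rewrite -(cvg_lim _ cE)//; apply: lime_le.
  by apply/cvg_ex; exists (mu (\bigcup_j E j)).
apply: nearW => j /=.
have [x Ax xj] : exists2 x, A x & S - j.+1%:R^-1 < phi x.
  have j0 : 0 < j.+1%:R^-1 :> R by rewrite invr_gt0.
  have [_ [x Ax <-] xS] := sup_adherent j0 supA.
  by exists x.
apply: le_trans (Aa x Ax); apply: le_outer_measure => y [Qy /= yS].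
by split=> //=; exact: le_trans yS (ltW xj).
Qed.

(** * The Euclidean norm in coordinates *)

Lemma dotv_ge0 (R : realType) (n : nat) (x : 'rV[R]_n) : 0 <= dotv x x.
Proof. by apply: sumr_ge0 => i _; rewrite -expr2 sqr_ge0. Qed.

Lemma coord_le_enorm (R : realType) (n : nat) (x : 'rV[R]_n) (i : 'I_n) :
  `|x 0 i| <= enorm x.
Proof.
rewrite -sqrtr_sqr ler_sqrt ?dotv_ge0// /dotv (bigD1 i)//= -expr2 lerDl.
by apply: sumr_ge0 => j _; rewrite -expr2 sqr_ge0.
Qed.

Lemma enorm_le_coord (R : realType) (n : nat) (x : 'rV[R]_n) (h : R) :
  0 <= h -> (forall i, `|x 0 i| <= h) -> enorm x <= n%:R * h.
Proof.
move=> h0 xh; have nh0 : 0 <= n%:R * h by rewrite mulr_ge0.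
rewrite -(ger0_norm nh0) -sqrtr_sqr ler_sqrt ?sqr_ge0// /dotv.
apply: (@le_trans _ _ (\sum_(i < n) h ^+ 2)).
  apply: ler_sum => i _; rewrite -expr2 -real_normK ?num_real//.
  by rewrite ler_pXn2r// nnegrE.
rewrite sumr_const card_ord exprMn -[leLHS]mulr_natl ler_wpM2r ?sqr_ge0//.
by rewrite -natrX ler_nat; case: n {x xh nh0} => // n; rewrite leq_pmulr.
Qed.

Lemma dotv_le_coord (R : realType) (n : nat) (u v : 'rV[R]_n) (b : R) :
  0 <= b -> (forall i, `|v 0 i| <= b) -> `|dotv u v| <= n%:R * b * enorm u.
Proof.
move=> b0 vb; apply: (le_trans (ler_norm_sum _ _ _)).
apply: (@le_trans _ _ (\sum_(i < n) b * enorm u)).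
  by apply: ler_sum => i _; rewrite normrM mulrC ler_pM// coord_le_enorm.
by rewrite sumr_const card_ord -[leLHS]mulr_natl mulrA.
Qed.

Lemma dotvC (R : realType) (n : nat) (u v : 'rV[R]_n) : dotv u v = dotv v u.
Proof. by apply: eq_bigr => i _; rewrite mulrC. Qed.

Lemma dotvBl (R : realType) (n : nat) (u v w : 'rV[R]_n) :
  dotv (u - v) w = dotv u w - dotv v w.
Proof. by rewrite /dotv -sumrB; apply: eq_bigr => i _; rewrite !mxE mulrBl. Qed.

Lemma dotvBr (R : realType) (n : nat) (u v w : 'rV[R]_n) :
  dotv u (v - w) = dotv u v - dotv u w.
Proof. by rewrite /dotv -sumrB; apply: eq_bigr => i _; rewrite !mxE mulrBr. Qed.

Lemma continuous_dotv (R : realType) (n : nat) (w : 'rV[R]_n) :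
  continuous (fun y : 'rV[R]_n => dotv y w).
Proof.
move=> x; apply: (cvg_big (F := nbhs x) add_continuous) => i _ /=.
by apply: cvgM; [exact: coord_continuous|exact: cvg_cst].
Qed.

(** * Cubical tiles *)

Definition cube (R : realType) (n : nat) (M : R) : set 'rV[R]_n :=
  [set x | forall i, `|x 0 i| <= M].
Arguments cube {R n} M.

(** The fibres of [tile h] are half-open cubes of side [h], disjoint by
    construction. *)
Definition tile (R : realType) (n : nat) (h : R) (x : 'rV[R]_n) :
  {ffun 'I_n -> int} := [ffun i => Num.floor (x 0 i / h)].

(** Ordinals shifted by [K] run through the integers from -K to K; [undup] makes
    each tile occur once, so that sums over the list are sums over disjoint
    tiles. *)
Definition index_box (n K : nat) : seq {ffun 'I_n -> int} :=
  undup [seq [ffun i => (g i : nat)%:Z - K%:Z]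
        | g : {ffun 'I_n -> 'I_(K + K).+1}
            <- enum {ffun 'I_n -> 'I_(K + K).+1}].

Lemma mem_index_box (n K : nat) (t : {ffun 'I_n -> int}) :
  (forall i, `|t i| <= K%:Z) -> t \in index_box n K.
Proof.
move=> tK; rewrite mem_undup; apply/mapP.
exists [ffun i => inord (absz (t i + K%:Z))]; first by rewrite mem_enum.
apply/ffunP => i; rewrite !ffunE; have := tK i; rewrite ler_norml => /andP[t1 t2].
have tK0 : 0 <= t i + K%:Z by rewrite -lerBlDr sub0r.
rewrite inordK; first by rewrite gez0_abs// addrK.
by rewrite ltnS -lez_nat gez0_abs// PoszD lerD2r.
Qed.

Lemma tile_mem_box (R : realType) (n : nat) (h M : R) (x : 'rV[R]_n) :
  0 < h -> cube M x -> tile h x \in index_box n (Num.bound `|M / h|).+1.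
Proof.
move=> h0 xM; apply: mem_index_box => i; rewrite ffunE.
have := xM i; rewrite !ler_norml => /andP[x1 x2].
have Mb : M / h < (Num.bound `|M / h|)%:R.
  by apply: le_lt_trans (ler_norm _) (archi_boundP (normr_ge0 _)).
rewrite floor_ge_int -ltzD1 floor_lt_int !intrD intrN /=.
have xMh : x 0 i / h <= M / h by rewrite ler_pM2r ?invr_gt0.
have Mxh : - (M / h) <= x 0 i / h by rewrite -mulNr ler_pM2r ?invr_gt0.
by apply/andP; split; lra.
Qed.

Lemma tile_dist (R : realType) (n : nat) (h : R) (x y : 'rV[R]_n) :
  0 < h -> tile h x = tile h y -> forall i, `|(y - x) 0 i| <= h.
Proof.
move=> h0 /ffunP xy i; have := xy i; rewrite !ffunE !mxE => e.
have := floor_itv (x 0 i / h); have := floor_itv (y 0 i / h); rewrite e.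
rewrite !ler_pdivlMr ?ltr_pdivrMr// intrD mulrDl mul1r.
move=> /andP[y1 y2] /andP[x1 x2]; rewrite ler_norml; apply/andP; split; lra.
Qed.

(** Bounded overlap: the tiles within sup distance [m * h] of [x] are
    translates of the tile of [x] by index vectors from a fixed finite list,
    the same for all [x] and [h]. *)
Lemma tile_near (R : realType) (n m : nat) (h : R) (x y : 'rV[R]_n) :
  0 < h -> (forall i, `|(y - x) 0 i| <= m%:R * h) ->
  tile h y - tile h x \in index_box n m.
Proof.
move=> h0 xy; apply: mem_index_box => i; have := xy i; rewrite !ffunE !mxE.
have Hfl (u v : R) : u - v <= m%:R * h ->
    Num.floor (u / h) <= Num.floor (v / h) + m%:Z.
  move=> uv; rewrite -ltzD1 floor_lt_int ltr_pdivrMr//.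
  have := floorD1_gt (v / h); rewrite ltr_pdivrMr// !intrD !mulrDl; lra.
rewrite !ler_norml => /andP[xy1 xy2]; apply/andP; split.
  by rewrite lerNl opprB lerBlDl; apply: Hfl; lra.
by rewrite lerBlDl; exact: Hfl.
Qed.

(** * Points with little mass behind them *)

Lemma caratheodory_open (R : realType) (n : nat)
    (mu : {outer_measure set 'rV[R]_n -> \bar R}) (U : set 'rV[R]_n) :
  is_measure mu -> open U -> mu.-caratheodory U.
Proof.
by move=> hmu oU; apply: measure_borel => //; exact: sub_sigma_algebra.
Qed.

Lemma caratheodory_lt (R : realType) (n : nat)
    (mu : {outer_measure set 'rV[R]_n -> \bar R}) (g : 'rV[R]_n -> R) (t : R) :
  is_measure mu -> continuous g -> mu.-caratheodory [set y | g y < t].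
Proof.
move=> hmu cg; apply: caratheodory_open => //.
by apply: (@open_comp _ _ g [set r | r < t]) => [x _|]; [exact: cg|exact: open_lt].
Qed.

Lemma caratheodory_le (R : realType) (n : nat)
    (mu : {outer_measure set 'rV[R]_n -> \bar R}) (g : 'rV[R]_n -> R) (t : R) :
  is_measure mu -> continuous g -> mu.-caratheodory [set y | g y <= t].
Proof.
move=> hmu cg.
rewrite (_ : mkset _ = ~` [set y | t < g y]); last first.
  by apply/seteqP; split=> y /=; rewrite ltNge; [move=> ->|move/negP; rewrite negbK].
apply: caratheodory_measurable_setC; apply: caratheodory_open => //.
by apply: (@open_comp _ _ g [set r | t < r]) => [x _|]; [exact: cg|exact: open_gt].
Qed.

Lemma caratheodory_tile (R : realType) (n : nat)
    (mu : {outer_measure set 'rV[R]_n -> \bar R}) (h : R) k :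
  is_measure mu -> 0 < h -> mu.-caratheodory (@tile R n h @^-1` [set k]).
Proof.
move=> hmu h0.
have -> : @tile R n h @^-1` [set k] = \big[setI/setT]_(i < n)
    (~` [set y : 'rV[R]_n | y 0 i < (k i)%:~R * h] `&`
     [set y | y 0 i < (k i + 1)%:~R * h]).
  apply/seteqP; split=> y /=.
    move=> <-; rewrite -bigcap_seq => i _ /=; rewrite ffunE.
    have := floor_itv (y 0 i / h); rewrite ler_pdivlMr// ltr_pdivrMr//.
    by move=> /andP[ly yl]; split=> //; apply/negP; rewrite -leNgt.
  rewrite -bigcap_seq => H; apply/ffunP => i; rewrite ffunE; apply: floor_def.
  have [|/= /negP] := H i; first by rewrite /= mem_index_enum.
  by rewrite -leNgt ler_pdivlMr// ltr_pdivrMr// => -> ->.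
elim/big_ind : _ => [||].
- rewrite -setC0; apply: caratheodory_measurable_setC.
  exact: caratheodory_measurable_set0.
- by move=> *; exact: caratheodory_measurable_setI.
move=> i _; apply: caratheodory_measurable_setI.
  apply: caratheodory_measurable_setC.
  by apply: caratheodory_lt => //; exact: coord_continuous.
by apply: caratheodory_lt => //; exact: coord_continuous.
Qed.

(** In one tile, an almost extremal point of [A] in the direction [w] has
    nearly all of the rest of [A] behind it, so the bound assumed at that point
    controls the whole of [A] in the tile by the mass of neighbouring tiles.
    Summing over the tiles counts each point of [D] once per neighbour, whence
    the factor [size (index_box n (2 * n.+1))]. *)
Lemma outer_measure_thin_behind_le (R : realType) (n : nat)
    (mu : {outer_measure set 'rV[R]_n -> \bar R}) (w : 'rV[R]_n)
    (M s a : R) (A D : set 'rV[R]_n) :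
  is_measure mu -> 0 < s -> 0 <= a -> A `<=` cube M ->
  (forall x, A x -> ecball x (2 * s) `<=` D) ->
  (forall x, A x ->
    (mu (ecball x s `\` hspace x w) <= a%:E * mu (ecball x (2 * s)))%E) ->
  (mu A <= (a * (size (index_box n (2 * n.+1)))%:R)%:E * mu D)%E.
Proof.
move=> hmu s0 a0 AM AD Aa.
(* Side s / (n + 1): tiles have Euclidean diameter at most n h <= s, and a
   distance of at most 2 s is at most 2 (n + 1) tile sides. *)
pose h := s / n.+1%:R.
have h0 : 0 < h by rewrite divr_gt0.
have hs : n.+1%:R * h = s by rewrite mulrC mulfVK.
have nhs : n%:R * h <= s by rewrite -hs ler_pM2r// ler_nat.
pose J := index_box n (2 * n.+1).
pose c := @tile R n h.
have mc k : mu.-caratheodory (c @^-1` [set k]) by exact: caratheodory_tile.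
pose K := index_box n (Num.bound `|M / h|).+1.
have AK x : A x -> c x \in K.
  by move=> /AM Mx; exact: tile_mem_box.
have tileA k : (mu (A `&` c @^-1` [set k]) <=
    a%:E * \sum_(j <- J) mu (D `&` c @^-1` [set (k + j)%R]))%E.
  apply: (@outer_measure_le_of_sublevels _ _ mu (fun y => dotv y w)
    (c @^-1` [set k]) _ (n%:R * `|M| * enorm w)) => //.
  - by move=> t; apply: caratheodory_le => //; exact: continuous_dotv.
  - move=> x [/AM xM _]; rewrite dotvC; apply: le_trans (ler_norm _) _.
    by apply: dotv_le_coord => // i; apply: le_trans (xM i) (ler_norm _).
  - apply: mule_ge0; first by rewrite lee_fin.
    by apply: sume_ge0 => j _; exact: outer_measure_ge0.
  move=> x [Ax /= cx].
  apply: (@le_trans _ _ (mu (ecball x s `\` hspace x w))).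
    apply: le_outer_measure => y [/= cy yx]; split.
      apply: le_trans nhs; apply: enorm_le_coord; first exact: ltW.
      by apply: (tile_dist h0); exact: etrans cx (esym cy).
    by rewrite /hspace /hcone /= mul0r dotvBl; apply/negP; rewrite -leNgt subr_le0.
  apply: le_trans (Aa _ Ax) _; rewrite lee_wpmul2l ?lee_fin//.
  apply: (@le_trans _ _ (mu (D `&` ecball x (2 * s)))).
    by apply: le_outer_measure => y xy; split=> //; exact: AD xy.
  (* Sort the ball by the position of a tile relative to that of x. *)
  apply: (@le_trans _ _ (\sum_(j <- J) mu ((D `&` ecball x (2 * s)%R) `&`
     (fun y => (c y - c x)%R) @^-1` [set j])))%E.
    apply: outer_measure_le_sum_fibres => y [_ xy]; apply: tile_near => // i.
    rewrite natrM -mulrA hs; apply: le_trans xy; exact: coord_le_enorm.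
  apply: lee_sum => j _; apply: le_outer_measure => y [[Dy _] /= yj].
  by split=> //=; rewrite -cx -yj addrC subrK.
apply: (le_trans (outer_measure_le_sum_fibres mu AK)).
apply: (@le_trans _ _ (\sum_(k <- K)
    (a%:E * \sum_(j <- J) mu (D `&` c @^-1` [set (k + j)%R])))%E).
  by apply: lee_sum => k _; exact: tileA.
rewrite -ge0_sume_distrr; last first.
  by move=> k _; apply: sume_ge0 => j _; exact: outer_measure_ge0.
rewrite EFinM -muleA lee_wpmul2l ?lee_fin// exchange_big /=.
(* For a fixed translation j, the tiles of index k + j are disjoint. *)
apply: (@le_trans _ _ (\sum_(j <- J) mu D)%E).
  apply: lee_sum => j _.
  have uK : uniq [seq k + j | k <- K].
    by rewrite map_inj_uniq ?undup_uniq//; exact: addIr.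
  by have := sum_fibres_le_outer_measure D uK mc; rewrite big_map.
by rewrite big_const_seq count_predT iter_addr_0 -/J mule_natl.
Qed.

(** * Summability along dyadic scales *)

(** The limsup lies in every tail union, whose measure is at most a tail of the
    series.  This is needed for arbitrary sets [F k]: a set of bad points has
    no evident reason to be measurable. *)
Lemma outer_measure_borel_cantelli (R : realType) (T : Type)
    (mu : {outer_measure set T -> \bar R}) (F : (set T)^nat) :
  (\sum_(0 <= k <oo) mu (F k) < +oo)%E ->
  mu [set x | forall N, exists2 k, (N <= k)%N & F k x] = 0%E.
Proof.
move=> Foo; apply/eqP; rewrite eq_le outer_measure_ge0 andbT.
have F0 k : xpredT k -> (0 <= mu (F k))%E by rewrite outer_measure_ge0.
have tail := nneseries_tail_cvg Foo F0.
rewrite -(cvg_lim _ tail)//; apply: lime_ge; first by apply/cvg_ex; exists 0%E.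
apply: nearW => N.
apply: le_trans (outer_measure_sigma_subadditive_tail mu N F).
apply: le_outer_measure => x /(_ N)[k Nk Fkx]; exists k => //=.
by apply/negP; rewrite -leqNgt.
Qed.

Lemma nondecreasing_on_measurable (R : realType) (D : set R) (f : R -> R) :
  is_interval D -> {in D &, {homo f : s t / s <= t}} -> measurable_fun D f.
Proof.
move=> iD f_nd mD.
apply: (measurability (@RGenCInfty.G R)) => [|/= _ [_] [r] -> <-|//].
  exact: RGenCInfty.measurableE.
apply: is_interval_measurable => s t/= [Ds fs] [Dt ft] u /andP[su ut].
have Du : D u by apply: (iD s t) => //; apply/andP.
have rs : r <= f s by case/andP: fs.
split=> //; apply/andP; split=> //.
by apply: le_trans rs _; apply: f_nd; rewrite // inE.
Qed.

(** On [2^-(k+1), 2^-k), an interval of length 2^-(k+1), monotonicity gives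
    f(t)/t >= f(2^-(k+1)) / 2^-k, so the k-th term of the series is at most
    twice the integral over that interval. *)
Lemma dyadic_sum_lt_pinfty (R : realType) (f : R -> R) :
  (forall t : R, 0 < t < 1 -> 0 < f t) ->
  (forall s t : R, 0 < s -> s <= t -> t < 1 -> f s <= f t) ->
  (\int[@lebesgue_measure R]_(t in `]0%R, 1%R[) (f t / t)%:E < +oo)%E ->
  (\sum_(0 <= k <oo) (f (2^-1 ^+ k.+1))%:E < +oo)%E.
Proof.
move=> f_pos f_incr f_int.
have d0 k : 0 < 2^-1 ^+ k :> R by rewrite exprn_gt0.
have d1 k : 2^-1 ^+ k.+1 < 1 :> R by rewrite exprn_ilt1// invf_lt1// ltr1n.
have dS k : 2^-1 ^+ k = 2 * 2^-1 ^+ k.+1 :> R by rewrite exprS mulrA divff// mul1r.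
have d_le j k : (j <= k)%N -> 2^-1 ^+ k <= 2^-1 ^+ j :> R.
  by move=> jk; rewrite ler_wiXn2l// invf_le1// ler1n.
pose E k : set R := `[2^-1 ^+ k.+1, 2^-1 ^+ k[%classic.
have E01 : \bigcup_k E k `<=` `]0%R, 1%R[%classic.
  move=> t [k _]; rewrite /E /= !in_itv /= => /andP[t1 t2].
  by rewrite (lt_le_trans (d0 k.+1) t1) (lt_le_trans t2 (d_le 0%N k _)).
have f0 (t : R) : `]0, 1[%classic t -> (0 <= (f t / t)%:E)%E.
  rewrite /= in_itv /= => /[dup] /f_pos ft /andP[t0 _].
  by rewrite lee_fin divr_ge0// ltW.
have mf : measurable_fun (`]0, 1[%classic : set R) (fun t => (f t / t)%:E).
  apply/measurable_EFinP; apply: measurable_funM.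
    apply: nondecreasing_on_measurable; first exact: interval_is_interval.
    move=> s t; rewrite !inE /= !in_itv /= => /andP[s0 _] /andP[_ t1] st.
    exact: f_incr.
  apply: open_continuous_measurable_fun; first exact: interval_open.
  move=> t; rewrite inE /= in_itv /= => /andP[t0 _].
  by apply: inv_continuous; rewrite gt_eqF.
have mE k : measurable (E k) by exact: measurable_itv.
have tE : trivIset setT E.
  apply/trivIsetP => i j _ _ ij; apply/seteqP; split=> // t [].
  wlog lij : i j ij / (i < j)%N => [H ti tj|].
    have [lij|] := ltnP i j; first exact: (H i j).
    rewrite leq_eqVlt eq_sym (negbTE ij) => lji.
    by apply: (H j i) => //; rewrite eq_sym.
  rewrite /E /= !in_itv /= => /andP[t1 _] /andP[_ t2].
  by have := lt_le_trans t2 (le_trans (d_le _ _ lij) t1); rewrite ltxx.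
have lE k : @lebesgue_measure R (E k) = (2^-1 ^+ k.+1)%:E.
  rewrite /E lebesgue_measure_itv /= lte_fin (dS k) ltr_pMl// ltr1n -EFinB.
  by congr _%:E; ring.
have sumE : (\sum_(0 <= k <oo) (2^-1 * f (2^-1 ^+ k.+1))%:E <=
    \int[@lebesgue_measure R]_(t in `]0%R, 1%R[) (f t / t)%:E)%E.
  apply: (@le_trans _ _
    (\int[@lebesgue_measure R]_(t in \bigcup_k E k) (f t / t)%:E)%E); last first.
    apply: ge0_subset_integral => //.
    exact: bigcupT_measurable.
  rewrite ge0_integral_bigcup//; last 2 first.
    - by apply: measurable_funS mf.
    - by move=> t /E01; exact: f0.
  apply: lee_nneseries => k _.
    by rewrite lee_fin mulr_ge0// ltW// f_pos// d0 d1.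
  apply: (@le_trans _ _ (\int[@lebesgue_measure R]_(t in E k)
      cst (f (2^-1 ^+ k.+1) / 2^-1 ^+ k)%:E t)%E).
    rewrite integral_cst; last exact: mE.
    rewrite [X in (_ * X)%E](lE k) -EFinM lee_fin.
    rewrite le_eqVlt; apply/orP; left; apply/eqP.
    rewrite (dS k); have := d0 k.+1; move: (2^-1 ^+ k.+1) => d dpos.
    by field; rewrite gt_eqF.
  have EkS : E k `<=` `]0%R, 1%R[%classic by move=> t Ekt; apply: E01; exists k.
  apply: ge0_le_integral => //.
  - exact: mE.
  - by move=> t _; rewrite /= lee_fin divr_ge0// ltW// f_pos// d0 d1.
  - exact: measurable_funS mf.
  move=> t Ekt; have := EkS _ Ekt; move: Ekt; rewrite /E /= !in_itv /=.
  move=> /andP[t1 t2] /andP[t0 t1']; rewrite /= lee_fin ler_pM//.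
  - by rewrite ltW// f_pos// d0 d1.
  - exact: f_incr.
  - by rewrite lef_pV2// ?posrE// ltW.
rewrite (eq_eseriesr
    (g := fun k => (2%:E * (2^-1 * f (2^-1 ^+ k.+1))%:E)%E)); last first.
  by move=> k _; rewrite -EFinM mulrA divff// mul1r.
rewrite nneseriesZl//; last first.
  by move=> k _; rewrite lee_fin mulr_ge0// ltW// f_pos// d0 d1.
rewrite lte_mul_pinfty//; exact: le_lt_trans sumE f_int.
Qed.

(** * Almost every point has enough mass behind it *)

Lemma bounded_cube (R : realType) (n : nat) (M : R) :
  bounded_set (cube M : set 'rV[R]_n).
Proof.
exists `|M|; split; first exact: num_real.
move=> t Mt x xM /=; rewrite [leLHS]/Num.norm /= mx_normrE; apply/bigmax_leP.
split=> [|[i j] _ /=]; first exact: le_trans (normr_ge0 M) (ltW Mt).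
by rewrite ord1; apply: le_trans (xM j) (le_trans (ler_norm _) (ltW Mt)).
Qed.

Lemma ecball_sub_cube (R : realType) (n : nat) (x : 'rV[R]_n) (M r : R) :
  cube M x -> ecball x r `<=` cube (M + r).
Proof.
move=> xM y xy i; rewrite -(subrK x y) mxE addrC.
apply: le_trans (ler_normD _ _) _; apply: lerD; first exact: xM.
exact: le_trans (coord_le_enorm _ _) xy.
Qed.

Lemma ecball_measure_lt_pinfty (R : realType) (n : nat)
    (mu : {outer_measure set 'rV[R]_n -> \bar R}) (x : 'rV[R]_n) (r : R) :
  is_measure mu -> (mu (ecball x r) < +oo)%E.
Proof.
move=> hmu; apply: (@le_lt_trans _ _ (mu (cube (enorm x + r)))).
  by apply: le_outer_measure; apply: ecball_sub_cube => i; exact: coord_le_enorm.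
by apply: (measure_bounded hmu); exact: bounded_cube.
Qed.

Lemma le_ecball (R : realType) (n : nat) (x : 'rV[R]_n) (r s : R) :
  r <= s -> ecball x r `<=` ecball x s.
Proof. by move=> rs y /= /le_trans; apply. Qed.

Lemma dyadic_scale (R : realType) (N : nat) (r : R) :
  0 < r -> r < 2^-1 ^+ N.+1 ->
  exists k, [/\ (N <= k)%N, 2^-1 ^+ k.+2 <= r & r < 2^-1 ^+ k.+1].
Proof.
move=> r0 rN.
have exm : exists m, 2^-1 ^+ m <= r.
  exists (Num.bound r^-1).
  have /upper_nthrootP b : (Num.bound r^-1 <= Num.bound r^-1)%N by [].
  by rewrite exprVn invf_ple ?posrE ?exprn_gt0// ltW.
have [m mr mmin] := ex_minnP exm.
have Nm : (N.+1 < m)%N.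
  rewrite ltnNge; apply/negP => mN.
  have dNm : 2^-1 ^+ N.+1 <= 2^-1 ^+ m :> R.
    by rewrite ler_wiXn2l// invf_le1// ler1n.
  by have := lt_le_trans rN (le_trans dNm mr); rewrite ltxx.
case: m mr mmin Nm => [|[|k]]// mr mmin Nm; exists k; split=> //.
by rewrite ltNge; apply/negP => /mmin; rewrite ltnn.
Qed.

(** Borel-Cantelli for the points that are bad at the dyadic scales, applied
    in each of countably many cubes that exhaust the space.  The vector [w] is
    arbitrary, so that it can later range over a finite net of the sphere whose
    points need not lie on the sphere. *)
Lemma almost_all_mass_behind (R : realType) (n : nat) (f : R -> R)
    (mu : {outer_measure set 'rV[R]_n -> \bar R}) (w : 'rV[R]_n) :
  (forall t : R, 0 < t < 1 -> 0 < f t) ->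
  (forall s t : R, 0 < s -> s <= t -> t < 1 -> f s <= f t) ->
  (\int[@lebesgue_measure R]_(t in `]0%R, 1%R[) (f t / t)%:E < +oo)%E ->
  is_measure mu ->
  mu_almost_all mu (fun x => \forall r \near 0^'+,
    ((f r)%:E * mu (ecball x r) < mu (ecball x r `\` hspace x w))%E).
Proof.
move=> f_pos f_incr f_int hmu.
pose d k : R := 2^-1 ^+ k.
have d0 k : 0 < d k by rewrite exprn_gt0.
have d1 k : d k.+1 < 1 by rewrite exprn_ilt1// invf_lt1// ltr1n.
have dS k : d k = 2 * d k.+1 by rewrite /d exprS mulrA divff// mul1r.
have fd k : 0 <= f (d k.+1) by rewrite ltW// f_pos// d0 d1.
pose bad k := [set x | (mu (ecball x (d k.+2) `\` hspace x w) <=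
  (f (d k.+1))%:E * mu (ecball x (d k.+1)))%E].
pose C : R := (size (index_box n (2 * n.+1)))%:R.
have badM (M : R) k : (mu (bad k `&` cube M) <=
    (f (d k.+1) * C)%:E * mu (cube (M + 1) : set 'rV[R]_n))%E.
  apply: (@outer_measure_thin_behind_le _ _ mu w M (d k.+2)) => //.
  - move=> x [_ xM]; rewrite -dS.
    move=> y xy; apply: (ecball_sub_cube xM).
    exact: le_ecball (ltW (d1 k)) _ xy.
  - by move=> x [xbad _]; rewrite -dS.
have nullM (M : R) :
    mu [set x | forall N, exists2 k, (N <= k)%N & (bad k `&` cube M) x] = 0%E.
  apply: outer_measure_borel_cantelli.
  have muM : mu (cube (M + 1) : set 'rV[R]_n) \is a fin_num.
    rewrite ge0_fin_numE ?outer_measure_ge0//; apply: (measure_bounded hmu).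
    exact: bounded_cube.
  set m := fine (mu (cube (M + 1) : set 'rV[R]_n)).
  have m0 : 0 <= m by rewrite fine_ge0// outer_measure_ge0.
  apply: (@le_lt_trans _ _ (\sum_(0 <= k <oo) ((C * m)%:E * (f (d k.+1))%:E))%E).
    apply: lee_nneseries => [k _ _|k _]; first exact: outer_measure_ge0.
    apply: le_trans (badM M k) _; rewrite -(fineK muM) -/m -!EFinM lee_fin.
    by rewrite [leRHS]mulrC mulrA.
  rewrite nneseriesZl//; last by move=> k _; rewrite lee_fin.
  by rewrite lte_mul_pinfty ?lee_fin ?mulr_ge0//; exact: dyadic_sum_lt_pinfty.
apply/eqP; rewrite eq_le outer_measure_ge0 andbT.
apply: (@le_trans _ _ (mu (\bigcup_M [set x | forall N,
    exists2 k, (N <= k)%N & (bad k `&` cube (M%:R : R)) x]))).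
  apply: le_outer_measure => x /= nx.
  exists (Num.bound (enorm x)) => //= N.
  have [k Nk bk] : exists2 k, (N <= k)%N & bad k x.
    apply: contrapT => nbad; apply: nx.
    exists (d N.+1) => //= r; rewrite /ball_ /= sub0r normrN => rN r0.
    rewrite (gtr0_norm r0) in rN.
    rewrite ltNge; apply/negP => rbad; apply: nbad.
    (* A failure at r is a failure at the dyadic scale around r: going down to
       d k.+2 the mass behind x decreases, going up to d k.+1 both f and the
       mass of the ball increase. *)
    have [k [Nk kr rk]] := dyadic_scale r0 rN; exists k => //.
    apply: (@le_trans _ _ (mu (ecball x r `\` hspace x w))).
      by apply: le_outer_measure; apply: setSD; exact: le_ecball.
    apply: (le_trans rbad); apply: lee_pmul => //.
    - by rewrite lee_fin ltW// f_pos// r0 (lt_trans rk).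
    - by rewrite lee_fin f_incr// ltW.
    - by apply: le_outer_measure; apply: le_ecball; exact: ltW.
  exists k => //; split=> // i; apply: le_trans (coord_le_enorm x i) _.
  by rewrite ltW// archi_boundP// sqrtr_ge0.
apply: (le_trans (outer_measure_sigma_subadditive mu _)).
by rewrite eseries0// => M _ _; exact: nullM.
Qed.

Lemma density_ratio_ge1 (R : realType) (n : nat) (f : R -> R)
    (mu : {outer_measure set 'rV[R]_n -> \bar R}) (x : 'rV[R]_n)
    (H : set 'rV[R]_n) (r : R) :
  is_measure mu -> 0 < f r ->
  ((f r)%:E * mu (ecball x r) < mu (ecball x r `\` H))%E ->
  (1 <= density_ratio f mu x H r)%E.
Proof.
move=> hmu fr0 rH; rewrite /density_ratio.
have Bfin : mu (ecball x r) \is a fin_num.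
  by rewrite ge0_fin_numE ?outer_measure_ge0//; exact: ecball_measure_lt_pinfty.
have B0 : (0 < mu (ecball x r))%E.
  apply: (@lt_le_trans _ _ (mu (ecball x r `\` H))).
    by apply: le_lt_trans rH; rewrite mule_ge0 ?outer_measure_ge0// lee_fin ltW.
  by apply: le_outer_measure; exact: subDsetl.
move: rH; rewrite -(fineK Bfin) -EFinM => rH.
have b0 : 0 < f r * fine (mu (ecball x r)).
  by rewrite mulr_gt0// -lte_fin fineK.
by rewrite inver gt_eqF// lee_pdivlMr// mul1e ltW.
Qed.

(** * From a finite net of half-spaces to all cones *)

Lemma limf_einf_ge (R : realType) (T : choiceType) (X : filteredType T)
    (g : X -> \bar R) (F : set_system X) (c : \bar R) :
  (\forall r \near F, (c <= g r)%E) -> (c <= limf_einf g F)%E.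
Proof.
move=> Fg; rewrite limf_einfE.
apply: (@le_trans _ _ (ereal_inf (g @` [set r | (c <= g r)%E]))).
  by apply: le_ereal_inf_tmp => _ [r /= cr <-].
by apply: ereal_sup_ubound; exists [set r | (c <= g r)%E].
Qed.

Lemma almost_all_near_seq (R : realType) (n : nat) (I : eqType)
    (mu : {outer_measure set 'rV[R]_n -> \bar R})
    (Q : I -> 'rV[R]_n -> R -> Prop) (F : set_system R)
    (s : seq I) : Filter F ->
  (forall k, mu_almost_all mu (fun x => \forall r \near F, Q k x r)) ->
  mu_almost_all mu
    (fun x => \forall r \near F, forall k, k \in s -> Q k x r).
Proof.
move=> FF aQ; rewrite /mu_almost_all; elim: s => [|k s IH].
  rewrite (_ : mkset _ = set0) ?outer_measure0//.
  by apply/seteqP; split=> x //=; apply; apply: nearW => r k.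
apply/eqP; rewrite eq_le outer_measure_ge0 andbT.
rewrite -[leRHS]adde0 -{1}(aQ k) -{1}IH.
apply: le_trans (outer_measureU2 mu _ _); apply: le_outer_measure => x nx.
apply: contrapT => /not_orP[/contrapT Qk /contrapT Qs]; apply: nx.
apply: filterS2 Qk Qs => r Qkr Qsr j.
by rewrite inE => /orP[/eqP->|/Qsr].
Qed.

(** The scalar products of y - x with [u] and [v] differ by at most
    n b |y - x|, which the opening [alpha] of the cone absorbs. *)
Lemma hcone_sub_hspace (R : realType) (n : nat) (x u v : 'rV[R]_n) (alpha b : R) :
  0 <= b -> n%:R * b <= alpha -> (forall i, `|(u - v) 0 i| <= b) ->
  hcone x u alpha `<=` hspace x v.
Proof.
move=> b0 nb uv y; rewrite /hspace /hcone /= mul0r => xu.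
have := dotv_le_coord (y - x) b0 uv; rewrite dotvBr ler_norml => /andP[_ uvb].
have : n%:R * b * enorm (y - x) <= alpha * enorm (y - x).
  by rewrite ler_wpM2r// sqrtr_ge0.
lra.
Qed.

Theorem theorem2p1 (R : realType) (n : nat) (hn : (0 < n)%N) (f : R -> R)
    (f_pos : forall t : R, 0 < t < 1 -> 0 < f t)
    (f_incr : forall s t : R, 0 < s -> s <= t -> t < 1 -> f s <= f t)
    (f_int : (\int[@lebesgue_measure R]_(t in `]0%R, 1%R[) (f t / t)%:E
               < +oo)%E)
    (mu : {outer_measure set 'rV[R]_n -> \bar R}) (hmu : is_measure mu) :
  (forall theta : 'rV[R]_n, esphere R n theta ->
     mu_almost_all mu (fun x =>
       (1 <= limf_einf (fun r => density_ratio f mu x (hspace x theta) r)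
               (0 : R)^'+)%E))
  /\
  (forall alpha : R, 0 < alpha <= 1 ->
     mu_almost_all mu (fun x =>
       (1 <= limf_einf
               (fun r => ereal_inf
                  [set density_ratio f mu x (hcone x theta alpha) r
                  | theta in esphere R n])
               (0 : R)^'+)%E)).
Proof.
have near01 : \forall r \near (0 : R)^'+, 0 < r < 1.
  near=> r; apply/andP; split; near: r; first exact: nbhs_right_gt.
  by apply: nbhs_right_lt.
have behind w := almost_all_mass_behind w f_pos f_incr f_int hmu.
have null_sub (P Q : 'rV[R]_n -> Prop) :
    (forall x, P x -> Q x) -> mu_almost_all mu P -> mu_almost_all mu Q.
  move=> PQ nP; apply/eqP; rewrite eq_le outer_measure_ge0 andbT -nP.
  by apply: le_outer_measure => x nQ /PQ.
split=> [theta _|alpha /andP[a0 _]].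
  apply: null_sub (behind theta) => x near_x.
  apply: limf_einf_ge; apply: filterS2 near01 near_x => r r01.
  by apply: density_ratio_ge1 => //; exact: f_pos.
pose b := alpha / n.+1%:R.
have b0 : 0 < b by rewrite divr_gt0.
have nb : n%:R * b <= alpha.
  by rewrite mulrCA ger_pMr// ler_pdivrMr// mul1r ler_nat.
(* The net consists of tile corners: each unit vector is within b, in every
   coordinate, of the corner of its own tile. *)
pose v (k : {ffun 'I_n -> int}) : 'rV[R]_n := \row_i ((k i)%:~R * b).
pose net := index_box n (Num.bound `|1 / b|).+1.
have behind_net := almost_all_near_seq net _ (fun k => behind (v k)).
apply: null_sub (behind_net _) => x near_x.
apply: limf_einf_ge; apply: filterS2 near01 near_x => r r01 rnet.
apply: le_ereal_inf_tmp => _ [theta theta1 <-].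
apply: density_ratio_ge1 => //; first exact: f_pos.
apply: lt_le_trans (rnet (tile b theta) _) _.
  apply: tile_mem_box => // i.
  by apply: le_trans (coord_le_enorm _ _) _; rewrite theta1.
apply: le_outer_measure; apply: setDS.
apply: hcone_sub_hspace (ltW b0) nb _ => i; rewrite !mxE ffunE.
have := floor_itv (theta 0 i / b).
rewrite ler_pdivlMr// ltr_pdivrMr// intrD mulrDl mul1r => /andP[lo hi].
by rewrite ler_norml; apply/andP; split; lra.
Unshelve. all: by end_near.
Qed.
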